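(* Let $G$ be a connected cubic graph with $n$ vertices and $m$ edges, where $m$ is odd, and let $e$ be a cut edge of $G$. Write $G-e=G_1\cup G_2$, where $G_1$ and $G_2$ are the two connected components of $G-e$. (a) If both $G_1$ and $G_2$ have an even number of edges, then $$p(M(G-e))=p(M(G)-e)=0.$$ (b) If both $G_1$ and $G_2$ have an odd number of edges, then $$p(M(G-e))=p(M(G)-e)=2^{m-n+1}3^{\frac{2n-m-1}{2}}=2^{\frac{n}{2}+1}3^{\frac{n-2}{4}}.$$
   Context: Graphs are finite and simple. A cubic graph is a graph in which every vertex has degree $3$. For a graph $G$ with vertex set $V(G)$ and edge set $E(G)$, the line graph $L(G)$ has vertex set $E(G)$, two distinct edges of $G$ being adjacent in $L(G)$ if they share an endpoint in $G$. The vertex-edge graph (also called the middle graph) $M(G)$ of $G$ has vertex set $V(G)\cup E(G)$ (disjoint union) and edge set $E(L(G))\cup\{ue,ve : e=uv\in E(G)\}$; that is, two elements of $E(G)$ are adjacent in $M(G)$ if they share an endpoint in $G$, each $e=uv\in E(G)$ is adjacent to its two endpoints $u$ and $v$, and no two elements of $V(G)$ are adjacent. A perfect matching (dimer covering) of a graph is a set of edges such that every vertex is incident with exactly one edge of the set. For a graph $H$, $p(H)$ denotes the number of perfect matchings of $H$. An edge $e$ of a connected graph $G$ is a cut edge if the graph $G-e$, obtained from $G$ by deleting the edge $e$ (keeping all vertices), is disconnected. In $M(G)-e$, $e$ is regarded as a vertex of $M(G)$, and $M(G)-e$ is the graph obtained from $M(G)$ by deleting this vertex and all edges of $M(G)$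 incident with it. *)

(* Defs.v *)
From HB Require Import structures.
From mathcomp Require Import all_boot.

Set Implicit Arguments.
Unset Strict Implicit.
Unset Printing Implicit Defensive.

Record sgraph := SGraph {
  svertex :> finType;
  sedge : rel svertex;
  sedge_sym : symmetric sedge;
  sedge_irr : irreflexive sedge }.

Definition degree (G : sgraph) (v : G) : nat := #|[set w | sedge v w]|.

Definition cubic (G : sgraph) : bool := [forall v : G, degree v == 3].

Definition edge_set (G : sgraph) : {set {set G}} :=
  [set [set uv.1; uv.2] | uv in [set uv : G * G | sedge uv.1 uv.2]].

Definition edge (G : sgraph) : finType := {a : {set G} | a \in edge_set G}.

Definition num_vertices (G : sgraph) : nat := #|svertex G|.

Definition num_edges (G : sgraph) : nat := #|edge_set G|.

Definition connected (G : sgraph) : bool :=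
  (0 < num_vertices G) && [forall u : G, forall v : G, connect (@sedge G) u v].

Definition components (G : sgraph) : {set {set G}} :=
  equivalence_partition (connect (@sedge G)) [set: G].

Section Induced.
Variables (G : sgraph) (A : {set G}).

Definition induced_rel : rel {x : G | x \in A} :=
  fun x y => sedge (val x) (val y).

Lemma induced_sym : symmetric induced_rel.
Proof. by move=> x y; exact: sedge_sym. Qed.

Lemma induced_irr : irreflexive induced_rel.
Proof. by move=> x; exact: sedge_irr. Qed.

Definition induced : sgraph := SGraph induced_sym induced_irr.

End Induced.

Definition del_vertex (G : sgraph) (v : G) : sgraph := induced [set~ v].

Arguments del_vertex : clear implicits.

Section DelEdge.
Variables (G : sgraph) (e : edge G).

Definition del_edge_rel : rel G :=
  fun x y => sedge x y && ([set x; y] != val e).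

Lemma del_edge_sym : symmetric del_edge_rel.
Proof. by move=> x y; rewrite /del_edge_rel sedge_sym setUC. Qed.

Lemma del_edge_irr : irreflexive del_edge_rel.
Proof. by move=> x; rewrite /del_edge_rel sedge_irr. Qed.

Definition del_edge : sgraph := SGraph del_edge_sym del_edge_irr.

End DelEdge.

Definition cut_edge (G : sgraph) (e : edge G) : bool :=
  ~~ connected (del_edge e).

Section LineMiddle.
Variable G : sgraph.

Definition line_rel : rel (edge G) :=
  fun a b => (a != b) && (val a :&: val b != set0).

Lemma line_sym : symmetric line_rel.
Proof. by move=> a b; rewrite /line_rel eq_sym setIC. Qed.

Lemma line_irr : irreflexive line_rel.
Proof. by move=> a; rewrite /line_rel eqxx. Qed.

Definition line_graph : sgraph := SGraph line_sym line_irr.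

Definition middle_rel : rel (G + edge G)%type :=
  fun x y => match x, y with
  | inl _, inl _ => false
  | inl v, inr a | inr a, inl v => v \in val a
  | inr a, inr b => @sedge line_graph a b
  end.

Lemma middle_sym : symmetric middle_rel.
Proof. by move=> [u|a] [v|b] //=; exact: line_sym. Qed.

Lemma middle_irr : irreflexive middle_rel.
Proof. by move=> [u|a] //=; exact: line_irr. Qed.

Definition middle : sgraph := SGraph middle_sym middle_irr.

End LineMiddle.

Definition perfect_matching (H : sgraph) (M : {set {set H}}) : bool :=
  (M \subset edge_set H) && [forall v : H, #|[set a in M | v \in a]| == 1].

Definition num_pm (H : sgraph) : nat :=
  #|[set M : {set {set H}} | perfect_matching M]|.

(* Main.v *)
Require Import Defs.
From mathcomp Require Import all_boot.
From mathcomp Require Import zify.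

(* The edges of the middle graph M(H) split into the cliques formed by a vertex
   v and the edges at v, so a perfect matching of M(H) assigns each edge of H to
   one of its endpoints, i.e. orients H, and all indegrees are odd since v is
   itself matched in its clique.  When all degrees are at most 3, a vertex of
   indegree 1 or 3 leaves 1 or 3 matchings of its clique; as the indegrees sum
   to m', the number of vertices of indegree 3 is (m' - n) / 2 for every
   orientation.  To count the odd orientations, note that reversing the edges of
   a path changes the indegree parities exactly at its two ends; hence all
   parity vectors compatible with the numbers of edges of the components are
   realized equally often.  Finally M(G) - e is M(G - e), and counting degrees in
   a component of G - e, which contains one endpoint of e, gives
   3 n_i = 2 m_i + 1, so n_i is odd. *)

Set Implicit Arguments.
Unset Strict Implicit.
Unset Printing Implicit Defensive.

(** * Parity of cardinalities and symmetric differences *)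

Lemma odd_cardE (T : finType) (A : {set T}) :
  odd #|A| = \big[addb/false]_x (x \in A).
Proof.
rewrite -sum1_card big_mkcond (big_morph odd oddD (erefl _)).
by apply: eq_bigr => x _; case: (x \in A).
Qed.

Definition symdiff (T : finType) (A B : {set T}) : {set T} :=
  [set x | (x \in A) (+) (x \in B)].

Lemma symdiffK (T : finType) (A : {set T}) : cancel (symdiff A) (symdiff A).
Proof. by move=> B; apply/setP=> x; rewrite !inE addKb. Qed.

Lemma odd_card_symdiff (T : finType) (A B : {set T}) :
  odd #|symdiff A B| = odd #|A| (+) odd #|B|.
Proof.
rewrite !odd_cardE -big_split; apply: eq_bigr => x _ /=.
by rewrite inE.
Qed.

(** * Parity vectors of subsets with respect to a partition into classes *)

Section OddClasses.
Variables (T I : finType) (c : T -> I) (rep : I -> T).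
Hypothesis repK : cancel rep c.

(** With sets read as vectors over the two-element field and [symdiff] as addition, this is the
    linear map summing the coordinates within each class of [c]. *)
Definition odd_classes (t : {set T}) : {set I} :=
  [set i | odd #|t :&: c @^-1: [set i]|].

Lemma odd_classes_symdiff (s t : {set T}) :
  odd_classes (symdiff s t) = symdiff (odd_classes s) (odd_classes t).
Proof.
apply/setP=> i; rewrite !inE -odd_card_symdiff; congr (odd #|pred_of_set _|).
by apply/setP=> x; rewrite !inE andb_addl.
Qed.

Lemma odd_classes1 (x : T) : odd_classes [set x] = [set c x].
Proof.
apply/setP=> i; rewrite !inE odd_cardE (bigD1 x) //= big1 ?inE ?eqxx ?addbF 1?eq_sym //.
by move=> y /negPf yx; rewrite !inE yx.
Qed.

(** A set of representatives meets each class in at most one point. So [odd_classes] is onto, with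
    [rep] giving a section. *)
Lemma odd_classes_rep (S : {set I}) : odd_classes (rep @: S) = S.
Proof.
apply/setP=> i; rewrite inE odd_cardE (bigD1 (rep i)) //= big1.
  by rewrite !inE repK eqxx andbT addbF mem_imset //; apply: can_inj repK.
move=> x xi; rewrite !inE; apply/negP => /andP[/imsetP[j _ xE]].
by rewrite xE repK => /eqP ji; rewrite xE ji eqxx in xi.
Qed.

(** All fibres of [odd_classes] have the same size, since adding the representatives of
    [symdiff s1 s2] injects the fibre of [s1] into that of [s2]. The [2 ^ #|I|] fibres partition the
    power set. *)
Lemma card_odd_classes (s : {set I}) :
  #|[set t | odd_classes t == s]| * 2 ^ #|I| = 2 ^ #|T|.
Proof.
have le s1 s2 : #|[set t | odd_classes t == s1]| <= #|[set t | odd_classes t == s2]|.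
  rewrite -(card_imset _ (can_inj (symdiffK (rep @: symdiff s1 s2)))).
  apply/subset_leq_card/subsetP=> _ /imsetP[t + ->]; rewrite !inE => /eqP <-.
  rewrite odd_classes_symdiff odd_classes_rep; apply/eqP/setP => i.
  by rewrite !inE addbAC addbb.
have {le} eq s1 s2 :
    #|[set t | odd_classes t == s1]| = #|[set t | odd_classes t == s2]|.
  by apply/eqP; rewrite eqn_leq !le.
rewrite -!cardsT -!card_powerset !powersetT !cardsT.
rewrite -[RHS]sum1_card (partition_big odd_classes predT) //=.
rewrite (eq_bigr (fun=> #|[set t | odd_classes t == s]|)).
  by rewrite sum_nat_const mulnC.
by move=> s' _; rewrite sum1dep_card; apply: eq.
Qed.

End OddClasses.

(** * Orientations with prescribed indegree parities *)

Section Orientations.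
Variable H : sgraph.
Implicit Types (o : {ffun edge H -> H}) (t : {set H}).

Lemma edgeP (a : edge H) : exists u w, sedge u w /\ val a = [set u; w].
Proof.
by case/imsetP: (valP a) => -[u w]; rewrite inE /= => uw ->; exists u, w.
Qed.

Lemma sedge_neq (u w : H) : sedge u w -> u != w.
Proof. by apply: contraTneq => ->; rewrite sedge_irr. Qed.

Lemma card_edge (a : edge H) : #|val a| = 2.
Proof. by have [u [w [/sedge_neq uw ->]]] := edgeP a; rewrite cards2 uw. Qed.

Lemma mem_edge_set (u w : H) : ([set u; w] \in edge_set H) = sedge u w.
Proof.
apply/imsetP/idP => [[[x y]] | uw]; last by exists (u, w); rewrite ?inE.
rewrite inE /= => xy E; have ux : u != w.
  by have := cards2 u w; rewrite E cards2 (sedge_neq xy); case: (u != w).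
have := set21 u w; have := set22 u w; rewrite E !inE.
case/pred2P => ew /pred2P[] eu; move: ux xy; rewrite ?ew ?eu ?eqxx // => _.
by rewrite sedge_sym.
Qed.

Definition heads o (v : H) : {set edge H} := [set a | o a == v].

(** An orientation is encoded by the head of each edge, one of its two endpoints; [#|heads o v|] is
    then the indegree of [v]. *)
Definition orients := family (fun a : edge H => mem (val a)).

Definition odd_heads o : {set H} := [set v | odd #|heads o v|].

Definition num_orients t : nat := #|[set o in orients | odd_heads o == t]|.

Lemma orientsP o : reflect (forall a, o a \in val a) (o \in orients).
Proof. exact: familyP. Qed.

(** Reversing the single edge uw is injective on orientations and changes the indegree by one at [u]
    and at [w], and nowhere else. *)
Lemma num_orients_toggle_edge (u w : H) t : sedge u w ->
  num_orients t <= num_orients (symdiff [set u] (symdiff [set w] t)).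
Proof.
move=> uw; have nuw := sedge_neq uw.
have aP : [set u; w] \in edge_set H by rewrite mem_edge_set.
pose a : edge H := Sub [set u; w] aP.
pose other (x : H) := if x == u then w else u.
pose flip o : {ffun edge H -> H} := [ffun b => if b == a then other (o b) else o b].
have in_a o : o \in orients -> (o a == u) || (o a == w).
  by move/orientsP/(_ a); rewrite !inE.
(* [flip] is an involution only where the head of [a] really is [u] or [w], hence the restriction to
   [orients]. *)
have flipK o : o \in orients -> flip (flip o) = o.
  move=> /in_a oa; apply/ffunP=> b; rewrite !ffunE; case: eqP => // ->.
  rewrite /other; case: (eqVneq (o a) u) oa => [-> _|_ /= /eqP ->].
    by rewrite eq_sym (negPf nuw).
  by rewrite eqxx.
rewrite /num_orients -(card_in_imset (f := flip)); last first.
  by move=> o1 o2; rewrite !inE => /andP[? _] /andP[? _] E; rewrite -[o1]flipK // E flipK.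
apply/subset_leq_card/subsetP=> _ /imsetP[o + ->]; rewrite !inE => /andP[oO /eqP <-].
apply/andP; split.
  apply/orientsP=> b; rewrite ffunE; case: eqP => [->|_]; last exact/orientsP.
  by rewrite /= /other; case: ifP; rewrite !inE eqxx ?orbT.
apply/eqP/setP=> x; rewrite !inE !odd_cardE (bigD1 a) //= [in RHS](bigD1 a) //=.
rewrite !inE ffunE eqxx !addbA; congr (_ (+) _); last first.
  by apply: eq_bigr => b /negPf ba; rewrite !inE ffunE ba.
have := in_a _ oO; rewrite /other; case: (eqVneq (o a) u) => [-> _|_ /= /eqP ->].
  by rewrite (eq_sym u) (eq_sym w); do 2!case: (x == _).
by rewrite (eq_sym u) (eq_sym w); do 2!case: (x == _).
Qed.

(** Edge by edge along a path: each inner vertex is toggled twice, so only the two ends change. *)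
Lemma num_orients_toggle (u w : H) t : connect (@sedge H) u w ->
  num_orients t <= num_orients (symdiff [set u] (symdiff [set w] t)).
Proof.
case/connectP => p; elim: p u w => [|x p IH] u w /=.
  by move=> _ ->; rewrite symdiffK.
case/andP => ux xp wE; apply: leq_trans (IH _ _ xp wE) _.
apply: leq_trans (num_orients_toggle_edge _ ux) _.
by rewrite symdiffK.
Qed.

Variables (I : finType) (c : H -> I) (rep : I -> H).
Hypothesis repK : cancel rep c.
Hypothesis connectE : forall x y, connect (@sedge H) x y = (c x == c y).

(** Both sets can be brought to the same normal form, consisting of class representatives only, by
    toggling pairs of connected vertices. *)
Lemma num_orients_classes t1 t2 : odd_classes c t1 = odd_classes c t2 ->
  num_orients t1 = num_orients t2.
Proof.
suff norm t : num_orients t = num_orients (rep @: odd_classes c t).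
  by move=> E; rewrite norm E -norm.
(* Induction on the number of elements of [t] that are not representatives; with none left, [t] is
   already in normal form. *)
have [k] := ubnP #|t :\: rep @: [set: I]|; elim: k t => // k IH t lek.
have [/subsetP sub|] := boolP (t \subset rep @: [set: I]).
  congr num_orients; apply/setP=> x; have [/imsetP[i _ ->]|xi] := boolP (x \in rep @: [set: I]).
    rewrite [RHS](mem_imset _ _ (can_inj repK)) [in RHS]inE odd_cardE (bigD1 (rep i)) //= big1.
      by rewrite !inE repK eqxx andbT addbF.
    move=> y yi; apply/negbTE; rewrite !inE negb_and -implybE.
    apply/implyP=> /sub /imsetP[j _ E]; move: yi; rewrite E repK.
    by apply: contraNneq => ->.
  apply/idP/idP => [/sub|]; first by rewrite (negPf xi).
  by case/imsetP => i _ E; rewrite E imset_f in xi.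
case/subsetPn => v vt vrep; set r := rep (c v).
have vr : connect (@sedge H) v r by rewrite connectE repK.
(* Move the element [v] to the representative [r] of its class; if [r] was already in [t], the two
   cancel. Toggling the same pair again restores [t], which yields both inequalities. *)
set t' := symdiff [set v] (symdiff [set r] t).
have tt' : symdiff [set v] (symdiff [set r] t') = t.
  by apply/setP=> x; rewrite !inE; case: (x == v); case: (x == r); case: (x \in t).
have -> : odd_classes c t = odd_classes c t'.
  by rewrite !odd_classes_symdiff !odd_classes1 repK symdiffK.
rewrite -IH.
  apply/eqP; rewrite eqn_leq; apply/andP; split; first exact: num_orients_toggle.
  by rewrite -[t in X in _ <= X]tt'; apply: num_orients_toggle.
rewrite -ltnS (leq_trans _ lek) // ltnS; apply/proper_card/properP; split.
  apply/subsetP=> x; rewrite !inE => /andP[xr]; rewrite (negPf xr) /=.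
  case: (eqVneq x v) => [-> //|_]; case: (eqVneq x r) => [xE|//].
  by rewrite xE imset_f in xr.
exists v; rewrite !inE (negPf vrep) vt ?eqxx // /=.
by case: (eqVneq v r) => // E; rewrite E imset_f in vrep.
Qed.

Definition num_class_edges (i : I) : nat :=
  #|[set a in edge_set H | a \subset c @^-1: [set i]]|.

Lemma edge_class (a : edge H) x y : x \in val a -> y \in val a -> c x = c y.
Proof.
have [u [w [uw ->]]] := edgeP a; have /eqP cuw : c u == c w.
  by rewrite -connectE connect1.
by rewrite !inE => /pred2P[] -> /pred2P[] ->.
Qed.

Lemma card_edge_sub (P : pred {set H}) : 
  #|[set a in edge_set H | P a]| = #|[set a : edge H | P (val a)]|.
Proof.
rewrite -(card_imset _ (@val_inj _ _ (edge H))); apply: eq_card => a.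
rewrite inE; apply/andP/imsetP => [[aE Pa]|[b + ->]].
  by exists (Sub a aE); rewrite ?inE.
by rewrite inE; split=> //; exact: valP.
Qed.

(* Every edge has its head in its own class, whatever the orientation. *)
Lemma odd_classes_heads o : o \in orients ->
  odd_classes c (odd_heads o) = [set i | odd (num_class_edges i)].
Proof.
move=> /orientsP oO; apply/setP=> i; rewrite !inE.
have -> : num_class_edges i = \sum_(x | c x == i) #|heads o x|.
  rewrite /num_class_edges card_edge_sub -sum1_card.
  rewrite (partition_big o (fun x => c x == i)) /=.
    apply: eq_bigr => x /eqP cx; rewrite sum1dep_card; apply: eq_card => a.
    rewrite !inE; case: eqVneq => [oa|//]; rewrite ?andbF // andbT.
    by apply/subsetP=> y ya; rewrite !inE -cx -oa (edge_class ya (oO a)).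
  by move=> a; rewrite inE => /subsetP/(_ _ (oO a)); rewrite !inE.
rewrite (big_morph odd oddD (erefl _)) odd_cardE [RHS]big_mkcond.
by apply: eq_bigr => x _; rewrite !inE andbC; case: (c x == i).
Qed.

Lemma card_orients : #|orients| = 2 ^ num_edges H.
Proof.
rewrite card_family foldrE big_map (eq_bigr (fun=> 2)) => [|a _]; last exact: card_edge.
by rewrite big_enum /= prod_nat_const card_sig.
Qed.

(** The [2 ^ num_edges H] orientations are spread equally over the sets with the class parities of
    [t], and [card_odd_classes] counts these sets. *)
Lemma num_orients_mul t :
  odd_classes c t = [set i | odd (num_class_edges i)] ->
  num_orients t * 2 ^ num_vertices H = 2 ^ (num_edges H + #|I|).
Proof.
move=> tE; rewrite expnD -card_orients -sum1_card.
rewrite (partition_big odd_heads (fun t' => odd_classes c t' == odd_classes c t)) /=.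
  rewrite (eq_bigr (fun=> num_orients t)) => [|t' /eqP t'E].
    by rewrite sum_nat_const -(card_odd_classes repK (odd_classes c t)) cardsE
      mulnA [num_orients t * _]mulnC.
  by rewrite -(num_orients_classes t'E) sum1dep_card.
by move=> o oO; rewrite odd_classes_heads // tE.
Qed.

Lemma num_orients_eq0 t :
  odd_classes c t != [set i | odd (num_class_edges i)] -> num_orients t = 0.
Proof.
move=> tE; apply: eq_card0 => o; rewrite !inE; apply/negP=> /andP[oO /eqP E].
by move/eqP: tE; apply; rewrite -E odd_classes_heads.
Qed.

End Orientations.

(** * Perfect matchings as fixed-point-free involutions along edges *)

Definition mates (H : sgraph) : {set {ffun H -> H}} :=
  [set f : {ffun H -> H} | [forall x, (f (f x) == x) && sedge x (f x)]].

Lemma matesP (H : sgraph) (f : {ffun H -> H}) :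
  reflect (forall x, f (f x) = x /\ sedge x (f x)) (f \in mates H).
Proof.
rewrite inE; apply: (iffP forallP) => fP x; have := fP x.
  by case/andP => /eqP.
by case=> -> ->; rewrite eqxx.
Qed.

(** An involution [f] corresponds to the matching of all pairs {x, f x}; conversely [f x] is the
    other end of the only matching edge at [x]. *)
Lemma num_pm_mates (H : sgraph) : num_pm H = #|mates H|.
Proof.
pose pm (f : {ffun H -> H}) := [set [set x; f x] | x : H].
have mem_pm (f : {ffun H -> H}) x a : f \in mates H -> a \in pm f -> x \in a -> a = [set x; f x].
  move=> /matesP fP /imsetP[y _ ->]; rewrite !inE => /pred2P[] -> //.
  by have [-> _] := fP y; rewrite setUC.
rewrite /num_pm -(card_in_imset (f := pm)) => [|f g fM gM E]; last first.
  apply/ffunP=> x; have : [set x; f x] \in pm g by rewrite -E; apply: imset_f.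
  move=> /mem_pm-/(_ x gM (set21 _ _)) /setP/(_ (f x)).
  rewrite !inE eqxx orbT; move/matesP: fM => /(_ x)[_ /sedge_neq].
  by rewrite eq_sym => /negPf -> /esym/eqP.
apply: eq_card => M; rewrite inE; apply/andP/imsetP => [[/subsetP ME /forallP M1]|[f fM ->]].
  have mateP x : {y | [set x; y] \in M & sedge x y}.
    apply: sig2W; have /cards1P[a aE] := M1 x.
    have : a \in [set a in M | x \in a] by rewrite aE set11.
    rewrite inE => /andP[aM xa]; have /imsetP[[u w]] := ME _ aM.
    rewrite inE /= => uw aE'; move: aM xa; rewrite aE' !inE => aM /pred2P[xE|xE].
      by exists w; rewrite ?xE // -aE'.
    by exists u; rewrite ?xE 1?setUC // sedge_sym.
  pose f := [ffun x => s2val (mateP x)].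
  have fM x : [set x; f x] \in M by rewrite ffunE; case: (mateP x).
  have fE x : sedge x (f x) by rewrite ffunE; case: (mateP x).
  have unM a x : a \in M -> x \in a -> a = [set x; f x].
    move=> aM xa; have /cards1P[b bE] := M1 x.
    have : a \in [set a in M | x \in a] by rewrite inE aM.
    have : [set x; f x] \in [set a in M | x \in a] by rewrite inE fM set21.
    by rewrite bE !inE => /eqP -> /eqP ->.
  exists f; last first.
    apply/setP=> a; apply/idP/imsetP => [aM|[x _ ->]//].
    have /imsetP[[u w] _ /= aE] := ME _ aM; exists u => //.
    by apply: unM => //; rewrite aE set21.
  apply/matesP=> x; split=> //; apply/esym/eqP.
  have := unM _ (f x) (fM x) (set22 _ _) => /setP/(_ x).
  by rewrite !inE eqxx /= (negPf (sedge_neq (fE x))) => /esym.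
split.
  apply/subsetP=> _ /imsetP[x _ ->]; rewrite mem_edge_set.
  by case/matesP/(_ x): fM.
apply/forallP=> x; apply/cards1P; exists [set x; f x].
apply/setP=> a; rewrite !inE; apply/andP/eqP => [[am xa]|->].
  exact: mem_pm am xa.
by rewrite set21; split=> //; apply: imset_f.
Qed.

(** Conjugation by an isomorphism is injective on [mates]; applying this to the isomorphism and to
    its inverse gives equality. *)
Lemma num_pm_iso (H K : sgraph) (h : H -> K) : bijective h ->
  (forall x y, sedge (h x) (h y) = sedge x y) -> num_pm H = num_pm K.
Proof.
suff le (H1 H2 : sgraph) (h1 : H1 -> H2) (h2 : H2 -> H1) :
    cancel h1 h2 -> cancel h2 h1 ->
    (forall x y, sedge (h1 x) (h1 y) = sedge x y) -> num_pm H1 <= num_pm H2.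
  case=> k hK kK hE; apply/eqP; rewrite eqn_leq (le _ _ h k) //= (le _ _ k h) //.
  by move=> x y; rewrite -hE !kK.
move=> h1K h2K hE; rewrite !num_pm_mates.
pose tr (f : {ffun H1 -> H1}) := [ffun y => h1 (f (h2 y))].
rewrite -(card_imset (f := tr)) => [|f g /ffunP E]; last first.
  by apply/ffunP=> x; have := E (h1 x); rewrite !ffunE h1K => /(can_inj h1K).
apply/subset_leq_card/subsetP=> _ /imsetP[f /matesP fM ->].
apply/matesP=> y; rewrite !ffunE h1K; have [-> fE] := fM (h2 y).
by rewrite h2K -[y in sedge y _]h2K hE.
Qed.

(** * Perfect matchings of the middle graph from odd orientations *)

Section MiddleMates.
Variable H : sgraph.
Hypothesis deg3 : forall v : H, #|[set a : edge H | v \in val a]| <= 3.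

(* A vertex [v] is matched to an edge [phi v]; the orientation [o] sends each
   edge to the vertex whose clique contains the matching edge covering it. *)
Definition odd_choices : {set {ffun edge H -> H} * {ffun H -> edge H}} :=
  [set p : {ffun edge H -> H} * {ffun H -> edge H} |
     (p.1 \in orients H) && (odd_heads p.1 == setT) &&
           [forall v, p.1 (p.2 v) == v]].

Lemma heads_le3 (o : {ffun edge H -> H}) v : o \in orients H -> #|heads o v| <= 3.
Proof.
move=> /orientsP oO; apply: leq_trans (deg3 v); apply/subset_leq_card/subsetP=> a.
by rewrite !inE => /eqP <-.
Qed.

Lemma val_edge_eq (a b : edge H) x y : x != y ->
  x \in val a -> y \in val a -> x \in val b -> y \in val b -> a = b.
Proof.
move=> xy xa ya xb yb; apply: val_inj.
suff E (d : edge H) : x \in val d -> y \in val d -> val d = [set x; y].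
  by rewrite (E a xa ya) (E b xb yb).
move=> xd yd; apply/esym/eqP; rewrite eqEcard card_edge cards2 xy andbT.
by apply/subsetP=> z; rewrite !inE => /pred2P[] ->.
Qed.

(** Together with [partner_exists], this shows that in an odd set of at most 3 elements, any two
    distinct ones determine a unique third. *)
Lemma partner_uniq (T : finType) (A : {set T}) p a b b' : #|A| <= 3 ->
  p \in A -> a \in A -> b \in A -> b' \in A ->
  a != p -> b != p -> b' != p -> b != a -> b' != a -> b = b'.
Proof.
move=> A3 pA aA bA b'A ap bp b'p ba b'a; apply/eqP/negPn/negP => bb'.
suff : #|[set p; a; b; b']| <= #|A|.
  rewrite setUC cardsU1 setUC cardsU1 cards2 !inE.
  rewrite (eq_sym p) ap (negPf bp) (negPf ba) (negPf b'p) (negPf b'a).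
  by rewrite eq_sym (negPf bb') /= => /leq_trans/(_ A3).
by apply/subset_leq_card/subsetP=> x; rewrite !inE -!orbA => /or4P[] /eqP ->.
Qed.

Lemma partner_exists (T : finType) (A : {set T}) p a : odd #|A| ->
  p \in A -> a \in A -> a != p -> exists b, [/\ b \in A, b != p & b != a].
Proof.
move=> Aodd pA aA ap.
have : 0 < #|A :\ p :\ a|.
  move: Aodd; rewrite (cardsD1 p) pA (cardsD1 a (A :\ p)) !inE ap aA.
  by case: #|_|.
by case/card_gt0P => b; rewrite !inE => /and3P[]; exists b.
Qed.

Lemma odd_choicesP (o : {ffun edge H -> H}) (phi : {ffun H -> edge H}) : reflect
  [/\ o \in orients H, forall v, odd #|heads o v| & forall v, o (phi v) = v]
  ((o, phi) \in odd_choices).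
Proof.
rewrite [_ \in odd_choices]inE /=; apply: (iffP andP)
  => [[/andP[oO /eqP/setP oT] /forallP pK]|[oO oT pK]].
  by split=> // v; [have := oT v; rewrite !inE | apply/eqP].
split; last by apply/forallP=> v; rewrite pK.
by rewrite oO; apply/eqP/setP=> v; rewrite !inE oT.
Qed.

Arguments odd_choicesP {o phi}.

(** In the clique of [v], the vertex [v] is paired with [phi v], and the two other edges directed
    into [v], if present, with each other. The last default value is never reached on [odd_choices],
    where such a partner exists. *)
Definition mate (p : {ffun edge H -> H} * {ffun H -> edge H}) :
    {ffun middle H -> middle H} :=
  [ffun x : middle H => match x with
   | inl v => inr (p.2 v)
   | inr a => if a == p.2 (p.1 a) then inl (p.1 a) else
       if [pick b in heads p.1 (p.1 a) | (b != p.2 (p.1 a)) && (b != a)] is Some b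
       then inr b else inl (p.1 a)
   end].

Section OddChoice.
Variables (o : {ffun edge H -> H}) (phi : {ffun H -> edge H}).
Hypothesis ophi : (o, phi) \in odd_choices.

Lemma mate_inl v : mate (o, phi) (inl v) = inr (phi v).
Proof. by rewrite ffunE. Qed.

Lemma mate_phi a : a = phi (o a) -> mate (o, phi) (inr a) = inl (o a).
Proof. by rewrite ffunE /= => {1}->; rewrite eqxx. Qed.

Lemma mate_inr a b : a != phi (o a) -> o b = o a -> b != phi (o a) -> b != a ->
  mate (o, phi) (inr a) = inr b.
Proof.
have [oO oT pK] := odd_choicesP ophi.
move=> ap ba bp nba; rewrite ffunE /= (negPf ap); case: pickP => [b' |/(_ b)].
  rewrite inE => /and3P[b'a b'p nb'a]; congr inr.
  apply: (@partner_uniq _ (heads o (o a)) (phi (o a)) a) => //; rewrite ?inE ?pK ?ba //.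
  exact: heads_le3.
by rewrite inE ba eqxx bp nba.
Qed.

Lemma partner a : a != phi (o a) ->
  exists b, [/\ o b = o a, b != phi (o a) & b != a].
Proof.
have [oO oT pK] := odd_choicesP ophi => ap.
have [||b [ba bp nba]] := partner_exists (oT (o a)) _ _ ap; rewrite ?inE ?pK //.
by exists b; split=> //; move: ba; rewrite inE => /eqP.
Qed.

Lemma mate_mates : mate (o, phi) \in mates (middle H).
Proof.
have [/orientsP oO oT pK] := odd_choicesP ophi.
apply/matesP=> -[v|a].
  rewrite mate_inl; split; first by rewrite mate_phi pK.
  by have := oO (phi v); rewrite pK.
have [aE|ap] := eqVneq a (phi (o a)).
  by rewrite mate_phi // mate_inl -aE; split=> //; apply: oO.
have [b [ba bp nba]] := partner ap; rewrite (mate_inr ap ba bp nba); split.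
  by rewrite (@mate_inr b a) ?ba // eq_sym.
rewrite /= /line_rel eq_sym nba; apply/set0Pn; exists (o a).
by rewrite inE oO -ba oO.
Qed.

End OddChoice.

(** The mates of the vertices give [phi]. The head of an edge is its mate, if that is a vertex, or
    else the only endpoint it shares with its mate. *)
Lemma mate_inj : {in odd_choices &, injective mate}.
Proof.
move=> [o1 phi1] [o2 phi2] h1 h2 E.
have phiE : phi1 = phi2.
  by apply/ffunP=> v; have /ffunP/(_ (inl v)) := E; rewrite !mate_inl => -[].
subst phi2; congr (_, _); apply/ffunP=> a.
have [/orientsP o1O _ _] := odd_choicesP h1; have [/orientsP o2O _ _] := odd_choicesP h2.
have /ffunP/(_ (inr a)) := E.
have [a1|a1] := eqVneq a (phi1 (o1 a)); have [a2|a2] := eqVneq a (phi1 (o2 a)).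
- by rewrite !mate_phi // => -[].
- by have [b [? ? ?]] := partner h2 a2; rewrite mate_phi // (@mate_inr _ _ h2 a b).
- by have [b [? ? ?]] := partner h1 a1; rewrite (@mate_inr _ _ h1 a b) // mate_phi.
have [b1 [ba1 ? nba]] := partner h1 a1; have [b2 [ba2 ? ?]] := partner h2 a2.
rewrite (@mate_inr _ _ h1 a b1) // (@mate_inr _ _ h2 a b2) // => -[bE].
(* If the two heads of [a] differed, both would be common endpoints of [a] and [b1], forcing
   [b1 = a] in a simple graph. *)
apply/eqP; apply: contraNT nba => oa; apply/eqP.
by apply: (val_edge_eq oa); rewrite -?ba1 -?ba2 -?bE ?o1O ?o2O // ?ba1 // bE ba2.
Qed.

Lemma mates_middle : mates (middle H) = mate @: odd_choices.
Proof.
apply/setP=> f; apply/idP/imsetP => [fM|[[o phi] h ->]]; last exact: mate_mates.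
move: fM => /matesP fP.
have phiP (v : H) : {a : edge H | f (inl v) = inr a}.
  by have [_] := fP (inl v); case: (f _) => // a; exists a.
pose phi := [ffun v => sval (phiP v)].
have fl v : f (inl v) = inr (phi v) by rewrite ffunE; case: (phiP v).
(* The head of an edge is recovered as its mate, if that is a vertex, and otherwise as an endpoint
   shared with the mate. *)
have headP (a : edge H) : {v : H | v \in val a &
    (if f (inr a) is inr b then v \in val b else f (inr a) == inl v :> middle H) : bool}.
  apply: sig2W; have [_] := fP (inr a); case: (f _) => [v va|b]; first by exists v.
  by case/andP=> _ /set0Pn[v]; rewrite inE => /andP[va vb]; exists v.
pose o := [ffun a => s2val (headP a)].
have oO a : o a \in val a by rewrite ffunE; case: (headP a).
have fr_inl (a : edge H) (v : H) : f (inr a) = inl v -> v = o a /\ a = phi v.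
  move=> fa; split; first by rewrite ffunE; case: (headP a) => w /= _; rewrite fa => /eqP[].
  by have [] := fP (inr a); rewrite fa fl => -[].
have fr_phi v : f (inr (phi v)) = inl v by have [] := fP (inl v); rewrite fl.
have oa_b (a b : edge H) : f (inr a) = inr b -> o a \in val b.
  by rewrite ffunE => fa; case: (headP a) => w /= _; rewrite fa.
have fr_inr (a b : edge H) : f (inr a) = inr b -> [/\ o b = o a, b != phi (o a) & b != a].
  move=> fa; have [fb] := fP (inr a); rewrite fa in fb *; case/andP=> nab _; split.
  - apply/eqP; apply: contraNT nab => oba; apply/eqP.
    by apply: (val_edge_eq oba); rewrite ?oO //; apply: oa_b.
  - by apply/eqP=> bE; move: fb; rewrite bE fr_phi.
  - by rewrite eq_sym.
have pK v : o (phi v) = v by have [] := fr_inl _ _ (fr_phi v).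
have oO' : o \in orients H by apply/orientsP.
have h : (o, phi) \in odd_choices.
  (* An even indegree would be 2, as it is at most 3 and [phi v] is counted. The one edge other than
     [phi v] directed into [v] would then have no possible mate. *)
  apply/odd_choicesP; split=> // v; apply/negPn/negP => ev.
  have /cards1P[a aE] : #|heads o v :\ phi v| == 1.
    have := heads_le3 v oO'; move: ev; rewrite (cardsD1 (phi v)) inE pK eqxx.
    by case: #|_| => [|[|[|]]].
  have : a \in heads o v :\ phi v by rewrite aE set11.
  rewrite !inE => /andP[ap /eqP oa]; case fa: (f (inr a)) => [w|b].
    by have [wE aE'] := fr_inl _ _ fa; move: ap; rewrite -oa -wE -aE' eqxx.
  have [ba bp nba] := fr_inr _ _ fa.
  have : b \in heads o v :\ phi v by rewrite !inE -oa bp ba eqxx.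
  by rewrite aE inE (negPf nba).
exists (o, phi) => //; apply/ffunP=> -[v|a]; first by rewrite mate_inl.
case fa: (f (inr a)) => [w|b].
  by have [wE aE] := fr_inl _ _ fa; rewrite mate_phi // -wE.
have [ba bp nba] := fr_inr _ _ fa; rewrite (@mate_inr _ _ h a b) //.
by apply/eqP=> aE; move: fa; rewrite aE fr_phi.
Qed.

(** Each indegree is 1 + 2k with k equal to 0 or 1, hence equals 3 ^ k. The indegrees sum to the
    number of edges, so the k sum to half its excess over the number of vertices. *)
Lemma prod_heads (o : {ffun edge H -> H}) : o \in orients H -> odd_heads o = setT ->
  \prod_v #|heads o v| = 3 ^ (num_edges H - num_vertices H)./2.
Proof.
move=> oO /setP oT; pose k v := #|heads o v|./2.
have hE v : #|heads o v| = 1 + (k v).*2.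
  by have := oT v; rewrite !inE => od; rewrite -[LHS]odd_double_half od.
have -> : num_edges H = num_vertices H + (\sum_v k v).*2.
  transitivity (\sum_v #|heads o v|); last first.
    rewrite (eq_bigr (fun v => 1 + (k v).*2)) // big_split sum1_card /=.
    by rewrite (big_morph _ doubleD (erefl 0.*2)).
  rewrite /num_edges -(card_sig (mem (edge_set H))) -sum1_card.
  rewrite (partition_big o predT) //=.
  by apply: eq_bigr => v _; rewrite sum1dep_card.
rewrite addKn doubleK (big_morph _ (expnD 3) (erefl _)); apply: eq_bigr => v _.
by have := heads_le3 v oO; rewrite hE; case: (k v) => [|[|?]].
Qed.

Lemma num_pm_middle : num_pm (middle H) =
  3 ^ (num_edges H - num_vertices H)./2 * num_orients [set: H].
Proof.
rewrite num_pm_mates mates_middle (card_in_imset mate_inj).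
rewrite -sum1_card (partition_big fst
  (fun o => (o \in orients H) && (odd_heads o == setT))) /=; last first.
  by move=> p; rewrite in_set => /andP[].
rewrite mulnC /num_orients -sum_nat_cond_const.
apply: eq_big => [o|o /andP[oO oT]]; first by rewrite !inE.
rewrite -(prod_heads oO (eqP oT)).
(* For fixed [o], the map [phi] is an independent choice in [heads o v] for every [v]. *)
transitivity #|family (fun v => mem (heads o v))|; last first.
  by rewrite card_family foldrE big_map big_enum.
rewrite -(card_imset (f := pair o)); last by move=> p1 p2 [].
rewrite sum1dep_card; apply: eq_card => -[o' phi]; rewrite !in_set /=.
apply/andP/imsetP => [[/andP[_ /forallP pK] /eqP o'E]|[phi' /familyP phiP [-> ->]]].
  by exists phi; rewrite -?o'E //; apply/familyP=> v; rewrite inE; apply: pK.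
rewrite oO oT eqxx; split=> //; apply/forallP=> v.
by have := phiP v; rewrite inE.
Qed.

End MiddleMates.

(** * Degree counting and induced subgraphs *)

Lemma edge_setP (G : sgraph) (a : {set G}) :
  reflect (exists u w, sedge u w /\ a = [set u; w]) (a \in edge_set G).
Proof.
apply: (iffP idP) => [aE|[u [w [uw ->]]]]; last by rewrite mem_edge_set.
exact: (edgeP (Sub a aE)).
Qed.

Lemma degreeE (G : sgraph) (v : G) : degree v = #|[set a in edge_set G | v \in a]|.
Proof.
rewrite /degree -(card_in_imset (f := fun w => [set v; w])) => [|w w'].
  apply: eq_card => a; rewrite inE; apply/imsetP/andP => [[w + ->]|[aE]].
    by rewrite inE mem_edge_set set21.
  have [u [w [uw ->]]] := edge_setP _ aE; rewrite !inE => /pred2P[->|->].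
    by exists w; rewrite ?inE.
  by exists u; rewrite ?inE 1?sedge_sym // setUC.
rewrite !inE => /sedge_neq vw /sedge_neq vw' /setP/(_ w).
by rewrite !inE eqxx orbT [w == v]eq_sym (negPf vw) => /esym/eqP.
Qed.

(** Double counting of the incidences between edges and vertices of [C]. *)
Lemma sum_degree (G : sgraph) (C : {set G}) :
  \sum_(v in C) degree v = \sum_(a in edge_set G) #|a :&: C|.
Proof.
under eq_bigr => v _ do rewrite degreeE -sum1_card (eq_bigl _ _ (in_set _)) big_mkcondr.
rewrite exchange_big; apply: eq_bigr => a _ /=.
rewrite -big_mkcondr sum1dep_card; apply: eq_card => v.
by rewrite !inE andbC.
Qed.

Lemma num_edges_induced (G : sgraph) (C : {set G}) :
  num_edges (induced C) = #|[set a in edge_set G | a \subset C]|.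
Proof.
rewrite /num_edges -(card_imset _ (imset_inj (@val_inj _ _ (induced C)))).
apply: eq_card => a; rewrite inE; apply/imsetP/andP => [[b /edge_setP[u [w [uw ->]]] ->]|].
  rewrite imsetU1 imset_set1 mem_edge_set; split=> //.
  by apply/subsetP=> x; rewrite !inE => /pred2P[] ->; apply: valP.
case=> /edge_setP[u [w [uw ->]]] /subsetP uwC.
have uC : u \in C by rewrite uwC ?set21.
have wC : w \in C by rewrite uwC ?set22.
exists [set Sub u uC; Sub w wC : induced C]; last by rewrite imsetU1 imset_set1.
by apply/edge_setP; exists (Sub u uC), (Sub w wC).
Qed.

(** * Deleting an edge, in general and from a cubic graph *)

Section DelEdgeTheory.
Variables (G : sgraph) (e : edge G).

Lemma edge_set_del_edge : edge_set (del_edge e) = edge_set G :\ val e.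
Proof.
apply/setP=> a; rewrite !inE; apply/edge_setP/andP => [[u [w [+ ->]]]|[ae /edge_setP]].
  by case/andP=> uw ne; split=> //; apply/edge_setP; exists u, w.
by case=> u [w [uw aE]]; exists u, w; split=> //; rewrite /sedge /= /del_edge_rel uw -aE.
Qed.

Lemma edge_del_edgeP (a : edge (del_edge e)) :
  val a != val e /\ val a \in edge_set G.
Proof.
by case: a => a aE /=; move: (aE); rewrite edge_set_del_edge => /setD1P[].
Qed.

Lemma num_edges_del_edge : num_edges G = (num_edges (del_edge e)).+1.
Proof. by rewrite /num_edges edge_set_del_edge (cardsD1 (val e)) (valP e). Qed.

Lemma del_edge_degree (v : G) : @degree (del_edge e) v <= degree v.
Proof.
by apply/subset_leq_card/subsetP=> w; rewrite !inE => /andP[].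
Qed.

(** The two graphs are isomorphic: the edges left after deleting [e] are the other edges of [G], as
    the same vertex pairs with the same incidences. *)
Lemma num_pm_middle_del_edge :
  num_pm (middle (del_edge e)) = num_pm (del_vertex (middle G) (inr e)).
Proof.
have upP (a : edge (del_edge e)) : val a \in edge_set G.
  by have [] := edge_del_edgeP a.
pose up (a : edge (del_edge e)) : edge G := Sub (val a) (upP a).
have up_e a : (inr (up a) : middle G) \in [set~ inr e : middle G].
  rewrite !inE; apply/eqP=> -[/(congr1 val) /= ae].
  by have [/eqP] := edge_del_edgeP a.
have inl_e (v : G) : (inl v : middle G) \in [set~ inr e : middle G] by rewrite !inE.
pose h (x : middle (del_edge e)) : del_vertex (middle G) (inr e) :=
  match x with
  | inl v => Sub (inl v : middle G) (inl_e v)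
  | inr a => Sub (inr (up a) : middle G) (up_e a)
  end.
have h_inj : injective h.
  move=> [v|a] [w|b] /(congr1 val) //= => [[->]//|[E]].
  by congr inr; apply: val_inj.
have h_surj y : exists x, h x = y.
  case: y => -[v|a] y; first by exists (inl v); apply: val_inj.
  have aE : val a \in edge_set (del_edge e).
    rewrite edge_set_del_edge !inE (valP a) andbT.
    by move: y; rewrite !inE; apply: contraNneq => /val_inj ->.
  by exists (inr (Sub (val a) aE)); apply: val_inj => /=; congr inr; apply: val_inj.
apply: (num_pm_iso (h := h)).
  have g y : {x | h x == y} by apply: sigW; have [x <-] := h_surj y; exists x.
  exists (fun y => sval (g y)) => [x|y]; last by apply/eqP; case: (g y).
  by apply: h_inj; apply/eqP; case: (g (h x)).
by case=> [v|a] [w|b].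
Qed.

Hypothesis cubG : cubic G.

Lemma cubic_sum (C : {set G}) : 3 * #|C| = \sum_(a in edge_set G) #|a :&: C|.
Proof.
rewrite -sum_degree (eq_bigr (fun=> 3)) => [|v _].
  by rewrite sum_nat_const mulnC.
by apply/eqP; move/forallP: cubG.
Qed.

Lemma cubic_num_edges : 3 * num_vertices G = 2 * num_edges G.
Proof.
rewrite /num_vertices -cardsT cubic_sum (eq_bigr (fun=> 2)) => [|a aE].
  by rewrite sum_nat_const mulnC.
by rewrite setIT; apply: (card_edge (Sub a aE)).
Qed.

(** In the degree sum over [C], the edge [e] counts once. Every other edge counts twice or not at
    all, because [C] is closed under adjacency in the graph without [e]. *)
Lemma cubic_cut (C : {set del_edge e}) :
  (forall x y : del_edge e, sedge x y -> (x \in C) = (y \in C)) ->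
  #|val e :&: C| = 1 -> 3 * #|C| = 1 + 2 * num_edges (induced C).
Proof.
move=> clC eC; rewrite (@cubic_sum C) (big_setD1 (val e) (valP e)) /= eC.
rewrite -edge_set_del_edge num_edges_induced; congr (1 + _).
rewrite mulnC -sum_nat_const [RHS](eq_bigl _ _ (in_set _)) big_mkcondr.
apply: eq_bigr => a aE.
have /= := card_edge (Sub a aE : edge (del_edge e)).
have [u [w [/clC uwC ->]]] := @edge_setP (del_edge e) a aE.
rewrite subUset !sub1set -uwC andbb; case: ifP => uC cuw.
  by rewrite (setIidPl _) // subUset !sub1set -uwC uC.
apply/eqP; rewrite cards_eq0; apply/eqP/setP=> x; rewrite !inE.
by apply/negP=> /andP[/pred2P[] ->]; rewrite -?uwC uC.
Qed.

End DelEdgeTheory.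

(** * Splitting a connected cubic graph at a cut edge *)

Theorem theorem1p6 (G : sgraph) (n m : nat) (e : edge G)
    (C1 C2 : {set del_edge e}) :
  connected G -> cubic G ->
  num_vertices G = n -> num_edges G = m -> odd m ->
  cut_edge e ->
  C1 != C2 -> components (del_edge e) = [set C1; C2] ->
  (~~ odd (num_edges (induced C1)) -> ~~ odd (num_edges (induced C2)) ->
     num_pm (middle (del_edge e)) = num_pm (del_vertex (middle G) (inr e)) /\
     num_pm (del_vertex (middle G) (inr e)) = 0)
  /\
  (* Since 2 * m = 3 * n and m is odd, all subtractions and divisions in the
     exponents below are exact. *)
  (odd (num_edges (induced C1)) -> odd (num_edges (induced C2)) ->
     [/\ num_pm (middle (del_edge e)) = num_pm (del_vertex (middle G) (inr e)),
         num_pm (del_vertex (middle G) (inr e))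
           = 2 ^ (m - n + 1) * 3 ^ ((2 * n - m - 1) %/ 2)
       & 2 ^ (m - n + 1) * 3 ^ ((2 * n - m - 1) %/ 2)
           = 2 ^ (n %/ 2 + 1) * 3 ^ ((n - 2) %/ 4)]).
Proof.
move=> /andP[_ /forallP conG] cubG nE mE odd_m _ C12 compE.
pose H := del_edge e; pose R := connect (@sedge H).
have Rsym : connect_sym (@sedge H) by apply: sym_connect_sym; apply: sedge_sym.
have compP (x : H) : [set y | R x y] \in [set C1; C2].
  rewrite -compE; apply/imsetP; exists x => //.
  by apply/setP=> y; rewrite !inE.
have repP (C : {set H}) : C \in [set C1; C2] -> exists x, C = [set y | R x y].
  rewrite -compE => /imsetP[x _ ->]; exists x.
  by apply/setP=> y; rewrite !inE.
have [x1 C1E] := repP C1 (set21 _ _); have [x2 C2E] := repP C2 (set22 _ _).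
have C1x1 : x1 \in C1 by rewrite C1E inE /R.
have C1x2 : x2 \notin C1.
  apply: contraNN C12; rewrite {1}C1E inE => R12; apply/eqP; rewrite C1E C2E.
  by apply/setP=> y; rewrite !inE /R (same_connect Rsym R12).
(* Booleans index the two components, so the orientation count is applied with [#|I|] equal to 2. *)
pose c (x : H) := x \in C1; pose rep (b : bool) := if b then x1 else x2.
have C2C : C2 = ~: C1.
  apply/setP=> y; rewrite inE; apply/idP/idP => [|yC1].
    rewrite C2E C1E !inE => R2y; apply: contra C1x2 => R1y.
    by rewrite C1E inE; apply: connect_trans R1y _; rewrite Rsym.
  have := compP y; rewrite !inE => /pred2P[E|<-]; last by rewrite inE /R.
  by move: yC1; rewrite -E inE /R connect0.
have repK : cancel rep c by case; rewrite /c /= ?C1x1 // (negPf C1x2).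
have connectE x y : connect (@sedge H) x y = (c x == c y).
  have C1R z : z \in C1 -> R x1 z by rewrite C1E inE.
  have C2R z : z \notin C1 -> R x2 z by rewrite -in_setC -C2C C2E inE.
  rewrite /c; apply/idP/eqP => [xy|].
    by rewrite !C1E !inE [RHS]Rsym [LHS]Rsym /R (same_connect Rsym xy).
  case: (boolP (y \in C1)) => [/C1R y1 /C1R x1'|/C2R y2 /negbT/C2R x2'].
    by apply: connect_trans y1; rewrite Rsym.
  by apply: connect_trans y2; rewrite Rsym.
have closC1 (x y : H) : sedge x y -> (x \in C1) = (y \in C1).
  by move=> xy; apply/eqP; rewrite -[_ == _]connectE connect1.
have eC1 : #|val e :&: C1| = 1.
  have [u [w [uw eE]]] := edgeP e.
  (* Were both endpoints of [e] on the same side, [C1] would be closed under adjacency in all of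
     [G], and connectedness would put [x2] into it. *)
  have cut : (u \in C1) != (w \in C1).
    apply: contraNneq C1x2 => uwC; have clos : closed (@sedge G) (mem C1).
      move=> x y xy /=; have [xye|ne] := eqVneq [set x; y] (val e); last first.
        by apply: closC1; rewrite /sedge /= /del_edge_rel xy.
      have : x \in val e by rewrite -xye set21.
      have : y \in val e by rewrite -xye set22.
      by rewrite eE !inE => /pred2P[] -> /pred2P[] ->.
    by rewrite -(closed_connect clos (forallP (conG x1) x2)).
  apply/eqP/cards1P; exists (if u \in C1 then u else w); apply/setP=> x.
  rewrite eE !inE; move: cut.
  case: (boolP (u \in C1)) => uC; case: (boolP (w \in C1)) => wC // _.
    case: (eqVneq x u) => [-> //|xu]; case: eqVneq => //= ->; exact/negbTE.
  case: (eqVneq x w) => [->|xw]; first by rewrite orbT.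
  by rewrite orbF; case: eqVneq => //= ->; exact/negbTE.
have eC2 : #|val e :&: C2| = 1.
  have := cardsID C1 (val e : {set H}); rewrite eC1 C2C -setDE add1n.
  by rewrite (card_edge e : #|(val e : {set H})| = 2) => -[].
have k1 := cubic_cut cubG closC1 eC1.
have k2 : 3 * #|C2| = 1 + 2 * num_edges (induced C2).
  by apply: cubic_cut => // x y xy; rewrite C2C !inE (closC1 x y xy).
have cE b : c @^-1: [set b] = if b then C1 else C2.
  by apply/setP=> x; case: b; rewrite ?C2C !inE /c ?eqb_id ?eqbF_neg.
have ncE b : num_class_edges c b = num_edges (induced (if b then C1 else C2)).
  by rewrite num_edges_induced /num_class_edges cE.
have deg3 (v : H) : #|[set a : edge H | v \in val a]| <= 3.
  rewrite -(card_edge_sub (fun a : {set H} => v \in a)) -degreeE.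
  apply: leq_trans (del_edge_degree _ _) _.
  by move/forallP: cubG => /(_ v)/eqP ->.
have classT b : (b \in odd_classes c [set: H]) = odd #|if b then C1 else C2|.
  by rewrite inE setTI cE.
have mn := cubic_num_edges cubG.
rewrite -num_pm_middle_del_edge num_pm_middle //.
split=> [ev1 ev2|od1 od2].
  split=> //; rewrite (num_orients_eq0 connectE) ?muln0 //.
  apply/eqP=> /setP/(_ true); rewrite classT inE ncE (negPf ev1) => od.
  (* By [k1] the size of [C1] is odd, so making all indegrees odd would need an odd number of edges
     inside [C1]. *)
  by move: k1 ev1 od; lia.
have := @num_orients_mul H _ c rep repK connectE [set: H].
rewrite card_bool => /(_ _)/wrap[].
  (* By [k1] and [k2] both components have an odd number of vertices, matching their odd numbers of
     edges. *)
  by apply/setP=> b; rewrite classT inE ncE; case: b; lia.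
have mE' : (num_edges H).+1 = m by rewrite -num_edges_del_edge.
rewrite (_ : num_vertices H = n) //.
(* From 3 n = 2 m, the number n / 2 = m / 3 is an integer; it is odd because m is, say 2 k + 1. *)
have [k [nk mk]] : exists k, n = 4 * k + 2 /\ m = 6 * k + 3.
  exists (n %/ 4); lia.
have -> : num_edges H = 6 * k + 2 by lia.
rewrite nk mk => NE.
(* The exponent is (m - 1) + 2 - n, with m - 1 edges and two components after the deletion. *)
have -> : num_orients [set: H] = 2 ^ (2 * k + 2).
  apply/eqP; rewrite -(@eqn_pmul2r (2 ^ (4 * k + 2))) ?expn_gt0 // NE -expnD.
  by apply/eqP; congr (2 ^ _); lia.
have -> : (6 * k + 2 - (4 * k + 2))./2 = k by lia.
have -> : (2 * (4 * k + 2) - (6 * k + 3) - 1) %/ 2 = k by lia.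
have -> : (4 * k + 2 - 2) %/ 4 = k by lia.
have -> : 6 * k + 3 - (4 * k + 2) + 1 = 2 * k + 2 by lia.
have -> : (4 * k + 2) %/ 2 + 1 = 2 * k + 2 by lia.
by rewrite mulnC.
Qed.
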